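(* There exists a Synchronous Strict PIP algorithm for the parallel prefix problem.
   Context: PRAM model: synchronous processors with a shared memory, each processor also having its own private memory, measured in words. Span is the maximum number of operations performed by a single processor. Synchronous Strict PIP (parallel in-place): let $1\le p\le n$ be the number of processors available, where $n$ is the input size. A PRAM algorithm is Synchronous Strict PIP if it (1) allocates no shared memory aside from the input, (2) uses $\Theta(1)$ private memory per processor, (3) has $O((n/p)\,\mathrm{polylog}(n))$ span, and (4) uses at most $\Theta(1)$ additional space, i.e. is strictly in-place, when run sequentially. Parallel prefix problem: given an array $A[0..n-1]$ in shared memory whose entries (one word each) can be combined by an associative operation $\oplus$ with identity (e.g. addition with identity $0$) computable in constant time, replace each $A[i]$ by its prefix value $A[0]\oplus\cdots\oplus A[i-1]$ (the identity for $i=0$), using the original entries. *)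

(* Defs.v *)
From mathcomp Require Import all_boot.

Set Implicit Arguments.
Unset Strict Implicit.
Unset Printing Implicit Defensive.

(* Machine words of w bits; built-in arithmetic is modulo 2 ^ w. *)
Definition word (w : nat) := 'I_(2 ^ w).

Lemma pow2_gt0 w : 0 < 2 ^ w.
Proof. by rewrite expn_gt0. Qed.

Definition to_word (w x : nat) : word w := Ordinal (ltn_pmod x (pow2_gt0 w)).

Inductive arith := Add | Sub | Mul | Div | Mod | Lt | Eq.

Definition eval_arith w (o : arith) (x y : word w) : word w :=
  to_word w
    match o with
    | Add => x + y
    | Sub => x + (2 ^ w - y)
    | Mul => x * y
    | Div => x %/ y
    | Mod => x %% y
    | Lt => x < y
    | Eq => x == y
    end.

(* Arguments d, a, b are addresses of private cells (d is the destination),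
   M is the private memory of the processor, S the shared memory, and l a
   position in the program. *)
Inductive instr :=
| Const (d c : nat)              (* M[d] := c mod 2 ^ w *)
| Move (d a : nat)               (* M[d] := M[a] *)
| Arith (o : arith) (d a b : nat)(* M[d] := M[a] o M[b] *)
| Combine (d a b : nat)          (* M[d] := M[a] (+) M[b] *)
| Fetch (d a : nat)              (* M[d] := M[M[a]] *)
| Put (a b : nat)                (* M[M[a]] := M[b] *)
| Read (d a : nat)               (* M[d] := S[M[a]] *)
| Write (a b : nat)              (* S[M[a]] := M[b] *)
| Goto (l : nat)
| IfZero (a l : nat).            (* goto l if M[a] = 0 *)

(* One finite program, run by every processor: it may depend neither on the
   input, nor on the input size, the number of processors, the word length or
   the combining operation.  A processor halts by leaving the program. *)
Definition program := seq instr.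

(* An input together with the machine it is run on.  The word length is
   arbitrary, as long as the input size fits in a word. *)
Record instance := Instance {
  width : nat;
  unit_word : word width;
  combine : Monoid.law unit_word;
  len : nat;
  len_fits : len < 2 ^ width;
  nproc : nat;
  nproc_gt0 : 0 < nproc;
  nproc_le : nproc <= len;
  input : len.-tuple (word width)
}.

Definition memory w := nat -> word w.

Definition update w (m : memory w) (a : nat) (v : word w) : memory w :=
  fun b => if b == a then v else m b.

Record pstate (w : nat) := PState { pc : nat; priv : memory w }.

Record config (w p : nat) := Config {
  shared : memory w;
  proc : 'I_p -> pstate w
}.

Section Semantics.

Variables (P : program) (I : instance).

Notation w := (width I).
Notation p := (nproc I).

(* Private cells 0, 1, 2, 3 initially hold the index of the processor, the
   number of processors, the input size and the identity of the operation. *)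
Definition init_priv (i : 'I_p) : memory w :=
  fun a => match a with
           | 0 => to_word w i
           | 1 => to_word w p
           | 2 => to_word w (len I)
           | 3 => unit_word I
           | _ => to_word w 0
           end.

(* The shared memory is unbounded; the input occupies its first cells. *)
Definition init : config w p :=
  Config (fun a => nth (to_word w 0) (input I) a)
         (fun i => PState 0 (init_priv i)).

Definition active (s : pstate w) : bool := pc s < size P.

Definition step_proc (sh : memory w) (s : pstate w) : pstate w :=
  let m := priv s in
  let next m' := PState (pc s).+1 m' in
  match onth P (pc s) with
  | None => s
  | Some (Const d c) => next (update m d (to_word w c))
  | Some (Move d a) => next (update m d (m a))
  | Some (Arith o d a b) => next (update m d (eval_arith o (m a) (m b)))
  | Some (Combine d a b) => next (update m d (combine I (m a) (m b)))
  | Some (Fetch d a) => next (update m d (m (m a)))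
  | Some (Put a b) => next (update m (m a) (m b))
  | Some (Read d a) => next (update m d (sh (m a)))
  | Some (Write _ _) => next m
  | Some (Goto l) => PState l m
  | Some (IfZero a l) => if m a == 0 :> nat then PState l m else next m
  end.

Definition step_shared (s : pstate w) (sh : memory w) : memory w :=
  if onth P (pc s) is Some (Write a b) then update sh (priv s a) (priv s b)
  else sh.

(* All processors read the old shared memory; the order in which the writes
   are folded is irrelevant for the exclusive-access runs considered below. *)
Definition step (c : config w p) : config w p :=
  Config (foldr (fun i => step_shared (proc c i)) (shared c) (enum 'I_p))
         (fun i => step_proc (shared c) (proc c i)).

Definition run (t : nat) : config w p := iter t step init.

(* Cells accessed by the instruction about to be executed. *)
Definition shared_cells (s : pstate w) : seq nat :=
  match onth P (pc s) with
  | Some (Read _ a) | Some (Write a _) => [:: nat_of_ord (priv s a)]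
  | _ => [::]
  end.

Definition private_cells (s : pstate w) : seq nat :=
  match onth P (pc s) with
  | Some (Const d _) => [:: d]
  | Some (Move d a) | Some (Read d a) => [:: d; a]
  | Some (Arith _ d a b) | Some (Combine d a b) => [:: d; a; b]
  | Some (Fetch d a) => [:: d; a; nat_of_ord (priv s a)]
  | Some (Put a b) => [:: a; b; nat_of_ord (priv s a)]
  | Some (Write a b) => [:: a; b]
  | Some (IfZero a _) => [:: a]
  | Some (Goto _) | None => [::]
  end.

Definition finished (T : nat) : Prop :=
  forall i : 'I_p, ~~ active (proc (run T) i).

(* Cost measures of a run that is finished at time T; they do not depend on
   the choice of such a T. *)

Definition operations (T : nat) (i : 'I_p) : nat :=
  \sum_(t < T) active (proc (run t) i).

Definition span (T : nat) : nat := \max_(i < p) operations T i.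

(* Memory use is the size of the smallest initial segment of the memory that
   contains all accessed cells, and the four preset ones for private memory. *)
Definition private_space (T : nat) (i : 'I_p) : nat :=
  maxn 4 (\max_(t < T) \max_(a <- private_cells (proc (run t) i)) a.+1).

Definition shared_space (T : nat) : nat :=
  maxn (len I)
    (\max_(t < T) \max_(i < p) \max_(a <- shared_cells (proc (run t) i)) a.+1).

Definition allocated_shared (T : nat) : nat := shared_space T - len I.

Definition additional_space (T : nat) : nat :=
  allocated_shared T + \sum_(i < p) private_space T i.

(* No shared cell is accessed by two processors in the same step, so that the
   run is legal, with the same effect, under every concurrent-access
   convention (EREW, CREW, CRCW). *)
Definition exclusive_access : Prop :=
  forall (t : nat) (i j : 'I_p), i != j ->
    ~~ has (mem (shared_cells (proc (run t) i)))
           (shared_cells (proc (run t) j)).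

End Semantics.

Definition pram_algorithm (P : program) : Prop :=
  forall I : instance, exclusive_access P I /\ exists T, finished P I T.

Definition no_shared_allocation (P : program) : Prop :=
  forall I T, finished P I T -> allocated_shared P I T = 0.

Definition constant_private_memory (P : program) : Prop :=
  exists c1 c2 : nat, 0 < c1 /\
    forall I T, finished P I T ->
      forall i : 'I_(nproc I), c1 <= private_space P T i <= c2.

(* span = O((n / p) (log n) ^ k) for some k, uniformly in 1 <= p <= n; the
   division is cleared, so that it is the exact one. *)
Definition polylog_span (P : program) : Prop :=
  exists c k n0 : nat, forall I T, n0 <= len I -> finished P I T ->
    nproc I * span P I T <= c * (len I * trunc_log 2 (len I) ^ k).

(* A sequential run is a run on a single processor. *)
Definition sequentially_in_place (P : program) : Prop :=
  exists c : nat, forall I T, nproc I = 1 -> finished P I T ->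
    additional_space P I T <= c.

Definition synchronous_strict_PIP (P : program) : Prop :=
  [/\ pram_algorithm P,
      no_shared_allocation P,
      constant_private_memory P,
      polylog_span P
    & sequentially_in_place P].

Definition solves_parallel_prefix (P : program) : Prop :=
  forall I T, finished P I T ->
    forall i, i < len I ->
      shared (run P I T) i
      = \big[combine I/unit_word I]_(x <- take i (input I)) x.

(* Main.v *)
(* The processors scan the array in chunks of p consecutive cells, one cell per
   processor, and keep the prefix of the preceding chunks in a register of
   processor 0, which combines it with the first entry of the chunk.  Inside a
   chunk, Hillis-Steele doubling rounds compute the inclusive prefixes in place:
   in the round at distance d every processor writes its value to its own cell
   and then reads the cell of the processor d places before it.  The reads are
   cyclic, hence a permutation of the chunk, so that all accesses are exclusive;
   the processors i < d discard what they read, by arithmetic rather than by a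
   jump, so that all of them remain at the same program position.  One more
   cyclic read at distance 1 turns inclusive prefixes into exclusive ones and
   hands the total of the chunk to processor 0 as its next carry.  A chunk takes
   O(log n) steps, and there are at most n / p + 1 of them. *)

Require Import Defs.
From mathcomp Require Import all_boot zify.
(* Restores [Sub], which eqtype shadows. *)
Import Defs.

Set Implicit Arguments.
Unset Strict Implicit.
Unset Printing Implicit Defensive.

(** * Lockstep execution *)

Definition local (ins : instr) : bool :=
  match ins with
  | Const _ _ | Move _ _ | Arith _ _ _ _ | Combine _ _ _ => true
  | _ => false
  end.

Definition dest (ins : instr) : nat :=
  match ins with
  | Const d _ | Move d _ | Arith _ d _ _ | Combine d _ _ => d
  | _ => 0
  end.

Section Lockstep.

Variables (P : program) (I : instance).

Local Notation w := (width I).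
Local Notation p := (nproc I).
Local Notation n := (len I).
Local Notation memories := ('I_p -> memory w).

Definition exec1 (m : memory w) (ins : instr) : memory w :=
  match ins with
  | Const d c => update m d (to_word w c)
  | Move d a => update m d (m a)
  | Arith o d a b => update m d (eval_arith o (m a) (m b))
  | Combine d a b => update m d (combine I (m a) (m b))
  | _ => m
  end.

Definition exec (code : seq instr) (m : memory w) : memory w :=
  foldl exec1 m code.

Lemma exec_frame code m a :
  a \notin [seq dest ins | ins <- code] -> exec code m a = m a.
Proof.
rewrite /exec; elim: code m => //= ins code IH m.
rewrite inE negb_or => /andP[/negPf a_ins /IH->].
by case: ins a_ins => //= *; rewrite /update; case: ifP => // /eqP; lia.
Qed.

(** The first half gives exclusive access, the second rules out shared allocation. *)
Definition legal (c : config w p) : Prop :=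
  (forall i j, i != j ->
     ~~ has (mem (shared_cells P (proc c i))) (shared_cells P (proc c j))) /\
  (forall i a, a \in shared_cells P (proc c i) -> a < n).

(* [Q] is reached from [c] in at most [k] steps, through legal configurations. *)
Fixpoint wp (k : nat) (Q : config w p -> Prop) (c : config w p) : Prop :=
  if k is k'.+1 then Q c \/ (legal c /\ wp k' Q (step P c)) else Q c.

Lemma wp_mono k k' (Q : config w p -> Prop) c : k <= k' -> wp k Q c -> wp k' Q c.
Proof.
elim: k k' c => [|k IHk] [|k'] c //=; first by left.
by rewrite ltnS => le_kk' [Qc|[legc /IHk-/(_ _ le_kk')]]; [left | right].
Qed.

Lemma wp_run k Q c : wp k Q c ->
  exists2 t, t <= k &
    Q (iter t (@step P I) c) /\
    forall u, u < t -> legal (iter u (@step P I) c).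
Proof.
elim: k c => [|k IHk] c /=; first by exists 0.
case=> [Qc|[legc /IHk[t le_tk [Qt leg_t]]]]; first by exists 0.
exists t.+1; rewrite ?iterSr; first by [].
split=> // -[|u] //= lt_ut; rewrite -iterS iterSr; exact: leg_t.
Qed.

(* Processors from [m] on have halted; the others are all at position [l]. *)
Definition lockstep (l m : nat) (s : memory w) (M : memories)
    (c : config w p) : Prop :=
  [/\ forall i : 'I_p, i < m -> proc c i = PState l (M i),
      forall i : 'I_p, m <= i -> ~~ active P (proc c i)
    & shared c =1 s].

Lemma inactive_onth (s : pstate w) : ~~ active P s -> onth P (pc s) = None.
Proof. by rewrite /active -leqNgt => le_Ps; rewrite onth_default. Qed.

Lemma step_inactive sh (s : pstate w) : ~~ active P s -> step_proc P sh s = s.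
Proof. by move=> /inactive_onth s_off; rewrite /step_proc s_off. Qed.

Lemma shared_step_id (c : config w p) :
  (forall i a b, onth P (pc (proc c i)) <> Some (Write a b)) ->
  shared (step P c) = shared c.
Proof.
move=> noW /=; elim: (enum _) => //= i r ->; rewrite /step_shared.
by case: (onth _ _) (noW i) => // -[] // a b /(_ a b).
Qed.

(** * One instruction executed in lockstep *)

Section Step.

Variables (l m : nat) (s : memory w) (M : memories) (c : config w p).
Hypothesis lock_c : lockstep l m s M c.

Lemma lockstep_pc i : onth P (pc (proc c i)) = if i < m then onth P l else None.
Proof.
have [run_c off_c _] := lock_c; case: ltnP => [/run_c-> //|/off_c].
exact: inactive_onth.
Qed.

Lemma lockstep_cells (a : nat) (ins : instr) :
  onth P l = Some ins ->
  (forall x : pstate w, pc x = l ->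
     shared_cells P x = [:: nat_of_ord (priv x a)]) ->
  (forall i : 'I_p, i < m -> M i a < n) ->
  (forall i j : 'I_p, i < m -> j < m -> M i a = M j a :> nat -> i = j) ->
  legal c.
Proof.
move=> Pl cells_l ltMn injM; have [run_c off_c _] := lock_c.
have cellsE i : shared_cells P (proc c i) =
    if i < m then [:: nat_of_ord (M i a)] else [::].
  case: ifP => [lt_im|]; first by rewrite cells_l run_c.
  move=> /negbT; rewrite -leqNgt => /off_c/inactive_onth.
  by rewrite /shared_cells => ->.
split=> [i j neq_ij|i x]; rewrite !cellsE; last first.
  by case: ifP => // lt_im; rewrite inE => /eqP->; exact: ltMn.
case: ifP => [lt_im|_]; case: ifP => // lt_jm.
rewrite /= orbF inE; apply: contraNN neq_ij => /eqP eqM; apply/eqP.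
by apply: injM => //; rewrite eqM.
Qed.

Lemma lockstep_no_cells ins :
  onth P l = Some ins ->
  (forall x : pstate w, pc x = l -> shared_cells P x = [::]) -> legal c.
Proof.
move=> Pl no_l; have [run_c off_c _] := lock_c.
have cellsE i : shared_cells P (proc c i) = [::].
  case: (ltnP i m) => [lt_im|/off_c/inactive_onth]; last by rewrite /shared_cells => ->.
  by rewrite no_l // run_c.
by split=> [i j _|i x]; rewrite !cellsE.
Qed.

(** Common part of all instructions other than writes. Processors from [m'] to [m - 1] leave the
    program in this step; only [step_exit] needs an [m'] other than [m]. *)
Lemma step_nowrite l' m' (s' : memory w) (M' : memories) :
  m' <= m -> s' =1 s ->
  (forall a b, onth P l <> Some (Write a b)) ->
  (forall (sh : memory w) (i : 'I_p), sh =1 s -> i < m' ->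
     step_proc P sh (PState l (M i)) = PState l' (M' i)) ->
  (forall (sh : memory w) (i : 'I_p), m' <= i < m ->
     ~~ active P (step_proc P sh (PState l (M i)))) ->
  lockstep l' m' s' M' (step P c).
Proof.
have [run_c off_c sh_c] := lock_c.
move=> le_m'm sE noW runP offP; split=> [i lt_im'|i le_m'i|x].
- by rewrite /= run_c ?runP // (leq_trans lt_im').
- case: (ltnP i m) => [lt_im|/off_c]; last by move=> off; rewrite /= step_inactive.
  by rewrite /= run_c // offP // le_m'i.
- rewrite shared_step_id ?sE ?sh_c // => i a b.
  by rewrite lockstep_pc; case: ifP.
Qed.

Lemma step_local ins : onth P l = Some ins -> local ins ->
  legal c /\ lockstep l.+1 m s (fun i => exec1 (M i) ins) (step P c).
Proof.
move=> Pl loc; split.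
  by apply: (lockstep_no_cells Pl) => x; rewrite /shared_cells => ->; rewrite Pl; case: ins loc {Pl}.
apply: step_nowrite => // [a b|sh i _ _|sh i].
- by rewrite Pl; case: ins loc {Pl} => // ? ? _ [].
- by rewrite /step_proc /= Pl; case: ins loc {Pl}.
- by case: leqP => //; case: ltnP.
Qed.

Lemma step_goto l' : onth P l = Some (Goto l') ->
  legal c /\ lockstep l' m s M (step P c).
Proof.
move=> Pl; split.
  by apply: (lockstep_no_cells Pl) => x; rewrite /shared_cells => ->; rewrite Pl.
apply: step_nowrite => // [a b|sh i _ _|sh i]; rewrite /step_proc /= Pl //.
by case: leqP => //; case: ltnP.
Qed.

(** The running processors have to agree on the test, since a split would break the lockstep. *)
Lemma step_branch a l' : onth P l = Some (IfZero a l') ->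
  legal c /\ forall b : bool,
    (forall i : 'I_p, i < m -> (M i a == 0 :> nat) = b) ->
    lockstep (if b then l' else l.+1) m s M (step P c).
Proof.
move=> Pl; split.
  by apply: (lockstep_no_cells Pl) => x; rewrite /shared_cells => ->; rewrite Pl.
move=> b Mb; apply: step_nowrite => // [x y|sh i _ lt_im|sh i].
- by rewrite Pl.
- by rewrite /step_proc /= Pl Mb //; case: (b).
- by case: leqP => //; case: ltnP.
Qed.

(** A split is harmless when the target lies outside the program: the processors that jump halt, and
    those still running form an initial segment. *)
Lemma step_exit a l' m' : onth P l = Some (IfZero a l') ->
  size P <= l' -> m' <= m ->
  (forall i : 'I_p, i < m -> (M i a == 0 :> nat) = (m' <= i)) ->
  legal c /\ lockstep l.+1 m' s M (step P c).
Proof.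
move=> Pl le_Pl' le_m'm Mm'; split.
  by apply: (lockstep_no_cells Pl) => x; rewrite /shared_cells => ->; rewrite Pl.
apply: step_nowrite => // [x y|sh i _ lt_im'|sh i /andP[le_m'i lt_im]].
- by rewrite Pl.
- by rewrite /step_proc /= Pl Mm' ?(leq_trans lt_im') // leqNgt lt_im'.
- by rewrite /step_proc /= Pl Mm' // le_m'i /active -leqNgt.
Qed.

Lemma step_read d a : onth P l = Some (Read d a) ->
  (forall i : 'I_p, i < m -> M i a < n) ->
  (forall i j : 'I_p, i < m -> j < m -> M i a = M j a :> nat -> i = j) ->
  legal c /\
  lockstep l.+1 m s (fun i => update (M i) d (s (M i a))) (step P c).
Proof.
move=> Pl ltMn injM; split.
  by apply: (lockstep_cells Pl) ltMn injM => x; rewrite /shared_cells => ->; rewrite Pl.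
apply: step_nowrite => // [x y|sh i sh_s lt_im|sh i].
- by rewrite Pl.
- by rewrite /step_proc /= Pl sh_s.
- by case: leqP => //; case: ltnP.
Qed.

Lemma step_write a b (s' : memory w) : onth P l = Some (Write a b) ->
  (forall i : 'I_p, i < m -> M i a < n) ->
  (forall i j : 'I_p, i < m -> j < m -> M i a = M j a :> nat -> i = j) ->
  (forall i : 'I_p, i < m -> s' (M i a) = M i b) ->
  (forall x, (forall i : 'I_p, i < m -> M i a <> x :> nat) -> s' x = s x) ->
  legal c /\ lockstep l.+1 m s' M (step P c).
Proof.
move=> Pl ltMn injM s'M s's; split.
  by apply: (lockstep_cells Pl) ltMn injM => x; rewrite /shared_cells => ->; rewrite Pl.
have [run_c off_c sh_c] := lock_c.
have writeE i sh : step_shared P (proc c i) sh =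
    if i < m then update sh (M i a) (M i b) else sh.
  rewrite /step_shared lockstep_pc; case: ifP => // lt_im.
  by rewrite Pl run_c.
(* The writes are folded over any list [r] of processors. A cell that is no target is untouched; a
   target gets the value of its only writer, by injectivity, whatever the order. *)
pose sh' r := foldr (fun i => step_shared P (proc c i)) (shared c) r.
have sh'0 r x : (forall i : 'I_p, i \in r -> i < m -> M i a <> x :> nat) -> sh' r x = s x.
  rewrite /sh'; elim: r => [|i r IHr] //= nox; rewrite writeE.
  have IH : foldr (fun i => step_shared P (proc c i)) (shared c) r x = s x.
    by apply: IHr => j rj; apply: nox; rewrite inE rj orbT.
  case: ifP => // lt_im; rewrite /update; case: eqP => // eqx.
  by case: (nox i _ lt_im); rewrite ?mem_head.
have sh'1 r (i : 'I_p) : i \in r -> i < m -> sh' r (M i a) = M i b.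
  rewrite /sh'; elim: r => [|j r IHr] //=; rewrite inE writeE.
  case: (eqVneq i j) => [<- _ lt_im|neq_ij /= ri lt_im].
    by rewrite lt_im /update eqxx.
  case: ifP => [lt_jm|_]; last exact: IHr.
  rewrite /update; case: eqP => [eqM|_]; last exact: IHr.
  by rewrite (injM i j lt_im lt_jm eqM) eqxx in neq_ij.
split=> [i lt_im|i le_mi|x].
- by rewrite /= run_c // /step_proc /= Pl.
- by rewrite /= step_inactive; exact: off_c.
- rewrite -[LHS]/(sh' (enum 'I_p) x).
  case: (boolP [exists i : 'I_p, (i < m) && (M i a == x :> nat)]) => [|no_x].
    by case/existsP=> i /andP[lt_im /eqP<-]; rewrite s'M // sh'1 ?mem_enum.
  have nox (i : 'I_p) : i < m -> M i a <> x :> nat.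
    move=> lt_im Mx; case/negP: no_x; apply/existsP; exists i.
    by rewrite lt_im Mx eqxx.
  by rewrite s's // sh'0 // => i _; exact: nox.
Qed.

End Step.

(** * Composition of steps *)

Lemma wp_step k Q c (R : config w p -> Prop) :
  legal c /\ R (step P c) -> (forall c', R c' -> wp k Q c') -> wp k.+1 Q c.
Proof. by case=> legc Rc RQ /=; right; split=> //; exact: RQ. Qed.

(** Straight-line code on private memory runs as one block. For a concrete program, the hypotheses
    on [code] hold by computation. *)
Lemma wp_local k Q code l m s M c :
  lockstep l m s M c ->
  take (size code) (drop l P) = code -> all local code ->
  (forall c', lockstep (l + size code) m s (fun i => exec code (M i)) c' ->
     wp k Q c') ->
  wp (size code + k) Q c.
Proof.
elim: code l M c => [|ins code IH] l M c lock_c /=.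
  by rewrite addn0 => _ _; apply.
case dropE: (drop l P) => [|ins' P'] //= [eq_ins eq_code] /andP[loc locs] wpQ.
have lt_lP : l < size P by rewrite ltnNge -subn_eq0 -size_drop dropE.
have Pl : onth P l = Some ins.
  by rewrite -(cat_take_drop l P) dropE -eq_ins onth_cat size_take lt_lP ltnn subnn.
have [legc lock1] := step_local lock_c Pl loc.
right; split=> //; apply: IH lock1 _ locs _.
  by rewrite -addn1 addnC -drop_drop dropE drop1.
by move=> c' lock_c'; apply: wpQ; rewrite addnS.
Qed.

End Lockstep.

(** * Arithmetic on words *)

Section WordArithmetic.

Variable w : nat.
Implicit Types x y z t : word w.

Lemma eval_add x y : x + y < 2 ^ w -> eval_arith Add x y = x + y :> nat.
Proof. exact: modn_small. Qed.

Lemma eval_mul x y : x * y < 2 ^ w -> eval_arith Mul x y = x * y :> nat.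
Proof. exact: modn_small. Qed.

Lemma eval_sub x y : y <= x -> eval_arith Sub x y = x - y :> nat.
Proof.
move=> le_yx; rewrite /= addnBA ?(ltnW (ltn_ord y)) // addnC -addnBA //.
by rewrite modnDl modn_small // (leq_ltn_trans (leq_subr _ _)).
Qed.

(* The intermediate sum may wrap around. *)
Lemma eval_add_sub x y z : z <= x + y -> x + y - z < 2 ^ w ->
  eval_arith Sub (eval_arith Add x y) z = x + y - z :> nat.
Proof.
move=> le_z lt_w; rewrite /= modnDml addnBA ?(ltnW (ltn_ord z)) // addnC.
by rewrite -addnBA // modnDl modn_small.
Qed.

Lemma eval_lt x y : 0 < w -> eval_arith Lt x y = (x < y) :> nat.
Proof.
move=> w_gt0; apply: modn_small.
by rewrite (leq_ltn_trans (leq_b1 _)) // -[1]/(2 ^ 0) ltn_exp2l.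
Qed.

(** One product is by 1 and the other by 0, so nothing overflows and one summand vanishes. *)
Lemma eval_select x t y z (b : bool) : x = b :> nat -> t = ~~ b :> nat ->
  eval_arith Add (eval_arith Mul y x) (eval_arith Mul z t) = if b then y else z.
Proof.
move=> xE tE; apply: val_inj; rewrite /= modnDm xE tE.
by case: b {xE tE}; rewrite /= muln0 muln1 ?addn0 ?add0n modn_small.
Qed.

End WordArithmetic.

(** * The program *)

(* Private cells: 4 carry (the identity except on processor 0), 5 the constant
   1, 6 number of cells left, 7 and 13 a flag and its
   negation, 8 start of the chunk, 9 own cell, 10 value held, 11 distance,
   12 value received.  Cell 1 is lowered to the size of the last chunk. *)

Definition shift (d : nat) : seq instr :=
  [:: Write 9 10; Arith Lt 7 0 d; Arith Lt 13 7 5; Arith Mul 12 7 1;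
      Arith Add 12 12 0; Arith Sub 12 12 d; Arith Add 12 12 8; Read 12 12].

(* M[d] := if M[7] then M[a] else M[b] *)
Definition select (d a b : nat) : seq instr :=
  [:: Arith Mul 14 a 7; Arith Mul 15 b 13; Arith Add d 14 15].

(* Positions: 3 next chunk, 14 next round, 31 end of the rounds, 47 halt. *)
Definition scan : program :=
  [:: Const 5 1; Move 4 3; Move 6 2;
      Arith Lt 7 0 6; IfZero 7 47;
      Arith Lt 7 6 1; IfZero 7 8; Move 1 6;
      Arith Sub 8 2 6; Arith Sub 6 6 1; Arith Add 9 8 0;
      Read 10 9; Combine 10 4 10; Move 11 5]
  ++ shift 11 ++ select 12 3 12 ++
  [:: Combine 10 12 10; Arith Sub 14 1 11; Arith Lt 7 11 14; IfZero 7 31;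
      Arith Add 11 11 11; Goto 14]
  ++ shift 5 ++ select 10 4 12 ++ select 4 12 3 ++
  [:: Write 9 10; Goto 3].

(** * Correctness of a chunk *)

Section Scan.

Variable I : instance.

Local Notation w := (width I).
Local Notation p := (nproc I).
Local Notation n := (len I).
Local Notation memories := ('I_p -> memory w).
Local Notation wp := (@wp scan I).
Local Notation lockstep := (@lockstep scan I).

(** * Segments of the input and cyclic shifts *)

Definition entry (j : nat) : word w := nth (to_word w 0) (input I) j.

Definition segment (lo hi : nat) : word w :=
  \big[combine I/unit_word I]_(lo <= j < hi) entry j.

Lemma segment1 j : segment j j.+1 = entry j.
Proof. exact: big_nat1. Qed.

Lemma segment_cat lo mid hi : lo <= mid <= hi ->
  combine I (segment lo mid) (segment mid hi) = segment lo hi.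
Proof. by case/andP=> le1 le2; rewrite /segment -big_cat_nat. Qed.

Lemma width_gt0 : 0 < w.
Proof.
rewrite lt0n; apply/eqP => w0; have := len_fits I; rewrite w0 expn0.
by have := leq_trans (nproc_gt0 I) (nproc_le I); lia.
Qed.

Definition patch (base m : nat) (v : nat -> word w) (s : memory w) : memory w :=
  fun x => if base <= x < base + m then v (x - base) else s x.

(** The residue of [i - d] modulo [m], for [i < m] and [0 < d <= m]. *)
Definition rot (m d i : nat) : nat := if i < d then m + i - d else i - d.

Lemma rot_lt m d i : 0 < d <= m -> i < m -> rot m d i < m.
Proof. by rewrite /rot; case: (ltnP i d); lia. Qed.

Lemma wp_write_patch l base m (v : nat -> word w) s (M : memories) c k Q :
  lockstep l m s M c -> onth scan l = Some (Write 9 10) ->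
  base + m <= n ->
  (forall i : 'I_p, i < m -> M i 9 = base + i :> nat) ->
  (forall i : 'I_p, i < m -> M i 10 = v i) ->
  m <= p ->
  (forall c', lockstep l.+1 m (patch base m v s) M c' -> wp k Q c') ->
  wp k.+1 Q c.
Proof.
move=> lock_c Pl le_n M9 M10 le_mp; apply: wp_step.
apply: (step_write lock_c Pl).
- by move=> i lt_im; rewrite M9 //; lia.
- by move=> i j lt_im lt_jm; rewrite !M9 // => /addnI/val_inj.
- by move=> i lt_im; rewrite M9 // M10 // /patch leq_addr ltn_add2l lt_im addKn.
move=> x nox; rewrite /patch; case: ifP => // /andP[le_bx lt_xb].
have lt_xm : x - base < m by lia.
have := nox (Ordinal (leq_trans lt_xm le_mp)) lt_xm.
by rewrite M9 //= subnKC.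
Qed.

(** Covers both uses of [shift]: in a round, with the distance in cell 11, and after the rounds,
    with the constant 1 of cell 5. For a fixed distance [rot] permutes the chunk, so the reads are
    exclusive. *)
Lemma wp_shift l d base m dd (v : nat -> word w) s (M : memories) c k Q :
  lockstep l m s M c -> (l, d) = (14, 11) \/ (l, d) = (31, 5) ->
  m <= p -> base + m <= n -> 0 < dd <= m ->
  (forall i : 'I_p, i < m ->
     [/\ M i 0 = i :> nat, M i 1 = m :> nat & M i 5 = 1 :> nat]) ->
  (forall i : 'I_p, i < m -> M i 8 = base :> nat /\ M i 9 = base + i :> nat) ->
  (forall i : 'I_p, i < m -> M i d = dd :> nat) ->
  (forall i : 'I_p, i < m -> M i 10 = v i) ->
  (forall (M' : memories) c', lockstep (l + 8) m (patch base m v s) M' c' ->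
     (forall i : 'I_p, i < m ->
        [/\ forall a : nat, a \notin [:: 7; 12; 13] -> M' i a = M i a,
            M' i 7 = (i < dd) :> nat,
            M' i 13 = ~~ (i < dd) :> nat
          & M' i 12 = v (rot m dd i)]) ->
     wp k Q c') ->
  wp (8 + k) Q c.
Proof.
move=> lock_c lE le_mp le_n dd_m Mregs Maddr Md Mv wpQ.
have lt_nw := len_fits I; have w0 := width_gt0.
rewrite addSn; apply: (wp_write_patch (base := base) lock_c) Mv le_mp _ => //.
- by case: lE => -[-> _].
- by move=> i /Maddr[].
move=> {lock_c}c lock_c.
(* The six local instructions of [shift], between its write and its read. *)
pose code := take 6 (drop 1 (shift d)).
pose M1 i := exec code (M i).
have M1E (i : 'I_p) : i < m ->
    [/\ forall a : nat, a \notin [:: 7; 12; 13] -> M1 i a = M i a,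
        M1 i 7 = (i < dd) :> nat,
        M1 i 13 = ~~ (i < dd) :> nat
      & M1 i 12 = base + rot m dd i :> nat].
  move=> lt_im; have [M0 Mm M5] := Mregs i lt_im; have [M8 M9] := Maddr i lt_im.
  have Mdd := Md i lt_im; have := rot_lt dd_m lt_im => lt_rot.
  have E7 : eval_arith Lt (M i 0) (M i d) = (i < dd) :> nat.
    by rewrite eval_lt // M0 Mdd.
  have E12 : eval_arith Sub (eval_arith Add (eval_arith Mul
      (eval_arith Lt (M i 0) (M i d)) (M i 1)) (M i 0)) (M i d) = rot m dd i :> nat.
    have Emul : eval_arith Mul (eval_arith Lt (M i 0) (M i d)) (M i 1) =
        (i < dd) * m :> nat.
      rewrite eval_mul E7 Mm //; case: (i < dd); lia.
    (* The flag times [m] plus [i] may wrap around, but the difference is below [m] and still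
       correct. *)
    by rewrite eval_add_sub Emul M0 Mdd; move: lt_rot; rewrite /rot; case: (ltnP i dd); lia.
  have E13 : eval_arith Lt (eval_arith Lt (M i 0) (M i d)) (M i 5) =
      ~~ (i < dd) :> nat.
    by rewrite eval_lt // E7 M5; case: (i < dd).
  have E : eval_arith Add (eval_arith Sub (eval_arith Add (eval_arith Mul
      (eval_arith Lt (M i 0) (M i d)) (M i 1)) (M i 0)) (M i d)) (M i 8) =
      base + rot m dd i :> nat.
    by rewrite eval_add E12 M8; lia.
  rewrite /M1 /code; case: lE => -[_ dE]; move: E7 E12 E13 E; rewrite dE => E7 E12 E13 E;
    (split; last exact: E; last exact: E13; last exact: E7);
    move=> a; rewrite !inE !negb_or => /and3P[/negPf a7 /negPf a12 /negPf a13];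
    by rewrite /exec /= /update a7 a12 a13.
have -> : 7 + k = size code + k.+1 by rewrite /code /= addnS.
apply: (wp_local lock_c).
- by rewrite /code; case: lE => -[-> ->].
- by rewrite /code; case: lE => -[_ ->].
move=> {lock_c}c lock_c; apply: wp_step.
  apply: (step_read (d := 12) (a := 12) lock_c).
  - by rewrite /code; case: lE => -[-> ->].
  - by move=> i lt_im; have [_ _ _ ->] := M1E i lt_im; have := rot_lt dd_m lt_im; lia.
  - move=> i j lt_im lt_jm; have [_ _ _ ->] := M1E i lt_im.
    have [_ _ _ ->] := M1E j lt_jm => /addnI rotE; apply: val_inj => /=.
    by move: rotE; rewrite /rot; case: (ltnP i dd); case: (ltnP j dd); lia.
have -> : (l.+1 + size code).+1 = l + 8 by rewrite /code /=; lia.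
move=> {lock_c}c lock_c; apply: (wpQ _ _ lock_c) => i lt_im.
have [E E7 E13 E12] := M1E i lt_im.
rewrite -/(M1 i) /patch E12 leq_addr ltn_add2l addKn rot_lt // /update.
split=> [a a_out|||] //; case: eqP => [a12|_]; last exact: E.
by rewrite a12 in a_out.
Qed.

(** * Doubling rounds *)

(* The value held by processor [i] before the round at distance [d]; the entry
   at [base] stands for the whole prefix ending there, because of the carry. *)
Definition window (base d i : nat) : word w :=
  segment (if i < d then 0 else (base + i).+1 - d) (base + i).+1.

Lemma window1 base i :
  window base 1 i = combine I (if i == 0 then segment 0 base else unit_word I)
                              (entry (base + i)).
Proof.
rewrite /window ltnS leqn0 subn1 /= -[entry _]segment1; case: eqP => [->|_].
  by rewrite addn0 segment_cat // leqnSn.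
by rewrite Monoid.mul1m.
Qed.

(** The window of [i - d] ends where that of [i] begins, so associativity merges them; for [i < d]
    the window already starts at 0. *)
Lemma window_double base d i :
  combine I (if i < d then unit_word I else window base d (i - d))
            (window base d i) = window base (d + d) i.
Proof.
rewrite /window; case: (ltnP i d) => [lt_id|le_di].
  by rewrite Monoid.mul1m; case: ifP => //; lia.
have -> : (base + (i - d)).+1 = (base + i).+1 - d by lia.
rewrite segment_cat; last by case: ifP; lia.
by congr segment; case: ifP; case: ifP; lia.
Qed.

Definition regs (m i : nat) (M : memory w) : Prop :=
  [/\ M 0 = i :> nat, M 1 = m :> nat, M 3 = unit_word I & M 5 = 1 :> nat].

Definition addrs (base i : nat) (M : memory w) : Prop :=
  M 8 = base :> nat /\ M 9 = base + i :> nat.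

(* The private cells that a round does not modify. *)
Definition kept (a : nat) : bool := (a < 10) && (a != 7).

Lemma wp_round d base m s (M : memories) c k Q :
  lockstep 14 m s M c -> m <= p -> base + m <= n -> 0 < d <= m ->
  (forall i : 'I_p, i < m -> regs m i (M i)) ->
  (forall i : 'I_p, i < m -> addrs base i (M i)) ->
  (forall i : 'I_p, i < m -> M i 10 = window base d i) ->
  (forall i : 'I_p, i < m -> M i 11 = d :> nat) ->
  (forall (M' : memories) c',
     lockstep 28 m (patch base m (window base d) s) M' c' ->
     (forall i : 'I_p, i < m ->
        [/\ forall a, kept a -> M' i a = M i a,
            M' i 10 = window base (d + d) i, M' i 11 = d :> nat
          & M' i 7 = (d < m - d) :> nat]) ->
     wp k Q c') ->
  wp (14 + k) Q c.
Proof.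
have lt_nw := len_fits I; have w0 := width_gt0.
move=> lock_c le_mp le_n dm Mregs Maddr Mv Md wpQ.
rewrite -(addnA 8 6).
apply: (wp_shift (base := base) (dd := d) lock_c _ _ _ _ _ _ Md Mv) => //;
  first by left.
  by move=> i /Mregs[].
move=> M1 {lock_c}c lock_c M1E.
pose code := select 12 3 12 ++
  [:: Combine 10 12 10; Arith Sub 14 1 11; Arith Lt 7 11 14].
apply: (wp_local (code := code) lock_c) => // {lock_c}c lock_c.
apply: (wpQ _ _ lock_c) => i lt_im.
have [E E7 E13 E12] := M1E i lt_im.
have [M0 M1m M3 M5] := Mregs i lt_im.
have E11 : M1 i 11 = d :> nat by rewrite E // Md.
have Esub : eval_arith Sub (M1 i 1) (M1 i 11) = m - d :> nat.
  by rewrite eval_sub E11 E // M1m; lia.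
split.
- move=> a /andP[lt_a a7].
  by rewrite exec_frame ?E // ?inE /= ?inE; lia.
- rewrite -[LHS]/(combine I (eval_arith Add (eval_arith Mul (M1 i 3) (M1 i 7))
    (eval_arith Mul (M1 i 12) (M1 i 13))) (M1 i 10)).
  (* Processors below [d] have selected the identity of cell 3 in place of the value received. *)
  rewrite (eval_select _ _ E7 E13) E12 !E // M3 Mv // -window_double /rot.
  by case: (i < d).
- by rewrite exec_frame // E11.
- rewrite -[X in nat_of_ord X]/(eval_arith Lt (M1 i 11)
    (eval_arith Sub (M1 i 1) (M1 i 11))).
  by rewrite eval_lt // Esub E11.
Qed.

(** Induction on the number [j] of rounds still allowed: doubling the distance preserves
    [m < d * 2 ^ j], and [j = 0] contradicts [d <= m]. *)
Lemma wp_rounds j d base m s (M : memories) c k Q :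
  lockstep 14 m s M c -> m <= p -> base + m <= n -> 0 < d <= m ->
  m < d * 2 ^ j ->
  (forall i : 'I_p, i < m -> regs m i (M i)) ->
  (forall i : 'I_p, i < m -> addrs base i (M i)) ->
  (forall i : 'I_p, i < m -> M i 10 = window base d i) ->
  (forall i : 'I_p, i < m -> M i 11 = d :> nat) ->
  (forall s' (M' : memories) c', lockstep 31 m s' M' c' ->
     (forall x, ~~ (base <= x < base + m) -> s' x = s x) ->
     (forall i : 'I_p, i < m ->
        (forall a, kept a -> M' i a = M i a) /\
        M' i 10 = segment 0 (base + i).+1) ->
     wp k Q c') ->
  wp (17 * j + k) Q c.
Proof.
have lt_nw := len_fits I.
elim: j d s M c => [|j IH] d s M c lock_c le_mp le_n dm lt_md Mregs Maddr Mv Md wpQ.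
  by move: lt_md dm; rewrite muln1; lia.
(* 14 steps up to the test, 1 for the test, 2 for doubling [d] and jumping back. *)
have -> : 17 * j.+1 + k = 14 + (1 + (2 + (17 * j + k))) by lia.
apply: (wp_round lock_c le_mp le_n dm) => // M1 {lock_c}c lock_c M1E.
have [legc branch] := step_branch lock_c (erefl : onth scan 28 = Some (IfZero 7 31)).
right; split=> //; move: (branch (~~ (d < m - d))) M1E => {branch lock_c legc}.
(* Testing [d < m - d] avoids forming [2d] before it is known to fit in a word. On exit
   [i < m <= 2d], so every window starts at 0. *)
case: ltnP => [lt_d|le_d] /= lock_c M1E; last first.
  apply: wp_mono (leq_addl 2 _) _; apply: wp_mono (leq_addl (17 * j) _) _.
  apply: wpQ (lock_c _) _ _.
  - by move=> i /M1E[_ _ _ ->].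
  - by move=> x /negPf x_out; rewrite /patch x_out.
  - move=> i lt_im; have [E E10 _ _] := M1E i lt_im.
    by split=> //; rewrite E10 /window; case: ifP => //; lia.
apply: (wp_local (code := [:: Arith Add 11 11 11]) (k := 1 + _) (lock_c _)) => //.
  by move=> i /M1E[_ _ _ ->].
move=> {lock_c}c lock_c.
apply: wp_step (step_goto lock_c (erefl : onth scan 30 = Some (Goto 14))) _.
move=> {lock_c}c lock_c; rewrite add0n.
apply: (IH (d + d) _ _ _ lock_c) => //.
- by lia.
- by move: lt_md; rewrite expnS; lia.
- move=> i lt_im; have [E _ _ _] := M1E i lt_im.
  by rewrite /regs !exec_frame // !E //; exact: Mregs.
- move=> i lt_im; have [E _ _ _] := M1E i lt_im.
  by rewrite /addrs !exec_frame // !E //; exact: Maddr.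
- by move=> i lt_im; have [_ E10 _ _] := M1E i lt_im; rewrite exec_frame.
- move=> i lt_im; have [_ _ E11 _] := M1E i lt_im.
  by rewrite -[X in nat_of_ord X]/(eval_arith Add (M1 i 11) (M1 i 11)) eval_add E11; lia.
move=> s' M' c' lock_c' s'E M'E; apply: wpQ lock_c' _ _.
  by move=> x x_out; rewrite s'E // /patch (negPf x_out).
move=> i lt_im; have [E _ _ _] := M1E i lt_im; have [E' E10] := M'E i lt_im.
split=> // a a_kept; rewrite E' // exec_frame ?E //= inE.
by move: a_kept; rewrite /kept; lia.
Qed.

Definition carried (base i : nat) (M : memory w) : Prop :=
  M 2 = n :> nat /\ M 4 = if i == 0 then segment 0 base else unit_word I.

Definition scanned (base : nat) (s : memory w) : Prop :=
  forall x, s x = if x < base then segment 0 x else entry x.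

Definition final (c : config w p) : Prop :=
  (forall i, ~~ active scan (proc c i)) /\
  (forall x, x < n -> shared c x = segment 0 x).

(** 27 = 2 + 3 + 22: the halting test, the adjustment of the chunk size, and the rest of the chunk
    outside the rounds. *)
Definition chunk_cost : nat := 27 + 17 * (trunc_log 2 n).+1.

Lemma wp_chunk base m s (M : memories) c k Q :
  lockstep 8 m s M c -> 0 < m <= p -> base + m <= n ->
  (forall i : 'I_p, i < m -> regs m i (M i)) ->
  (forall i : 'I_p, i < m -> carried base i (M i)) ->
  (forall i : 'I_p, i < m -> M i 6 = n - base :> nat) ->
  scanned base s ->
  (forall s' (M' : memories) c', lockstep 3 m s' M' c' ->
     (forall i : 'I_p, i < m -> regs m i (M' i)) ->
     (forall i : 'I_p, i < m -> carried (base + m) i (M' i)) ->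
     (forall i : 'I_p, i < m -> M' i 6 = n - (base + m) :> nat) ->
     scanned (base + m) s' -> wp k Q c') ->
  wp (22 + 17 * (trunc_log 2 n).+1 + k) Q c.
Proof.
have lt_nw := len_fits I; have w0 := width_gt0.
move=> lock_c /andP[m_gt0 le_mp] le_n Mregs Mcar Mrem s_base wpQ.
(* In order: addresses, read, carry and initial distance, rounds, cyclic shift, selections, write,
   jump. *)
have -> : 22 + 17 * (trunc_log 2 n).+1 + k =
  3 + (1 + (2 + (17 * (trunc_log 2 n).+1 + (8 + (6 + (1 + (1 + k))))))) by lia.
pose code1 := [:: Arith Sub 8 2 6; Arith Sub 6 6 1; Arith Add 9 8 0].
apply: (wp_local (code := code1) lock_c) => // {lock_c}c lock_c.
pose M1 i := exec code1 (M i).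
have M1E (i : 'I_p) : i < m ->
    [/\ regs m i (M1 i), carried base i (M1 i),
        M1 i 6 = n - (base + m) :> nat & addrs base i (M1 i)].
  move=> lt_im; have [M0 Mm _ _] := Mregs i lt_im.
  have M6 := Mrem i lt_im; have [M2 _] := Mcar i lt_im.
  have M8 : eval_arith Sub (M i 2) (M i 6) = base :> nat.
    by rewrite eval_sub M2 M6; lia.
  split; first exact: Mregs.
  - exact: Mcar.
  - rewrite -[X in nat_of_ord X]/(eval_arith Sub (M i 6) (M i 1)).
    by rewrite eval_sub M6 Mm; lia.
  - split; first exact: M8.
    rewrite -[X in nat_of_ord X]/(eval_arith Add
      (eval_arith Sub (M i 2) (M i 6)) (M i 0)).
    by rewrite eval_add M8 M0; lia.
apply: wp_step.
  apply: (step_read (d := 10) (a := 9) lock_c) => //.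
  - by move=> i lt_im; have [_ _ _ [_ M9]] := M1E i lt_im; rewrite -/(M1 i) M9; lia.
  - move=> i j lt_im lt_jm; have [_ _ _ [_ M9i]] := M1E i lt_im.
    have [_ _ _ [_ M9j]] := M1E j lt_jm.
    by rewrite -/(M1 i) -/(M1 j) M9i M9j => /addnI/val_inj.
move=> {lock_c}c lock_c; pose code2 := [:: Combine 10 4 10; Move 11 5].
apply: (wp_local (code := code2) lock_c) => // {lock_c}c lock_c.
rewrite [_ + size _]/= in lock_c.
apply: (wp_rounds (j := (trunc_log 2 n).+1) (d := 1) (base := base) lock_c) => //.
(* Enough rounds, as [m <= n < 2 ^ (trunc_log 2 n).+1]. *)
- by rewrite mul1n; apply: leq_ltn_trans (trunc_log_ltn _ _) => //; lia.
- move=> i lt_im; have [_ _ _ Ma] := M1E i lt_im; exact: Ma.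
- move=> i lt_im; have [_ [_ M4] _ [_ M9]] := M1E i lt_im.
  rewrite window1 -[LHS]/(combine I (M1 i 4) (s (M1 i 9))).
  by rewrite M4 M9 s_base; case: ltnP => //; lia.
- by move=> i lt_im; have [[_ _ _ M5] _ _ _] := M1E i lt_im.
move=> s2 M2 {lock_c}c lock_c s2E M2E.
(* Inclusive prefixes, which the shift at distance 1 turns into exclusive ones. *)
pose v i := segment 0 (base + i).+1.
have {}M2E (i : 'I_p) : i < m ->
    [/\ regs m i (M2 i), carried base i (M2 i),
        M2 i 6 = n - (base + m) :> nat, addrs base i (M2 i) & M2 i 10 = v i].
  move=> /[dup] lt_im /M1E[Mr Mc M6 Ma].
  have [E E10] := M2E i lt_im; split; last exact: E10.
  - by rewrite /regs !E.
  - by rewrite /carried !E.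
  - by rewrite E.
  - by rewrite /addrs !E.
apply: (wp_shift (base := base) (dd := 1) (v := v) lock_c) => //; first by right.
- by move=> i /M2E[[]].
- by move=> i /M2E[].
- by move=> i /M2E[[]].
- by move=> i /M2E[].
move=> M3 {lock_c}c lock_c M3E.
(* The first selection uses the old carry before the second one replaces it. *)
pose code3 := select 10 4 12 ++ select 4 12 3.
apply: (wp_local (code := code3) lock_c) => // {lock_c}c lock_c.
pose M4 i := exec code3 (M3 i).
have M4E (i : 'I_p) : i < m ->
    [/\ regs m i (M4 i), carried (base + m) i (M4 i),
        M4 i 6 = n - (base + m) :> nat, addrs base i (M4 i)
      & M4 i 10 = segment 0 (base + i)].
  move=> lt_im; have [E E7 E13 E12] := M3E i lt_im.
  have [Mr [E2 E4] E6 Ma _] := M2E i lt_im; have [_ _ E3 _] := Mr.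
  have M4E a : kept a -> a != 4 -> M4 i a = M2 i a.
    move=> a_kept a4; rewrite -E; last by rewrite !inE; move: a_kept; rewrite /kept; lia.
    by apply: exec_frame; rewrite /= !inE; move: a_kept; rewrite /kept; lia.
  split.
  - by rewrite /regs !M4E.
  - rewrite /carried M4E //; split=> //.
    rewrite -[LHS]/(eval_arith Add (eval_arith Mul (M3 i 12) (M3 i 7))
      (eval_arith Mul (M3 i 3) (M3 i 13))).
    rewrite (eval_select _ _ E7 E13) ltnS leqn0 E12 E // E3 /v /rot.
    (* Processor 0 has received [v (m - 1)], the prefix up to the end of this chunk, as its next
       carry. *)
    by case: eqP => // -> /=; congr segment; lia.
  - by rewrite M4E.
  - by rewrite /addrs !M4E.
  - rewrite -[LHS]/(eval_arith Add (eval_arith Mul (M3 i 4) (M3 i 7))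
      (eval_arith Mul (M3 i 12) (M3 i 13))).
    rewrite (eval_select _ _ E7 E13) ltnS leqn0 E12 E // E4 /v /rot ltnS leqn0.
    by case: eqP => [->|i_gt0] /=; rewrite ?addn0 //; congr segment; lia.
rewrite [_ + size _]/= in lock_c.
apply: (wp_write_patch (base := base) (v := fun i => segment 0 (base + i)) lock_c) => //.
- by move=> i /M4E[_ _ _ []].
- by move=> i /M4E[].
move=> {lock_c}c lock_c.
apply: wp_step (step_goto lock_c (erefl : onth scan 46 = Some (Goto 3))) _.
move=> {lock_c}c lock_c; apply: (wpQ _ _ _ lock_c).
- by move=> i /M4E[].
- by move=> i /M4E[].
- by move=> i /M4E[].
move=> x; rewrite /patch; case: ifP => [/andP[le_bx ->]|x_out]; first by rewrite subnKC.
rewrite x_out s2E ?x_out // s_base; move: x_out.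
by case: (ltnP x base); case: (ltnP x (base + m)) => //; lia.
Qed.

(** * Iteration over the chunks *)

(* Processors without a cell in the next chunk halt. *)
Lemma wp_halt base m s (M : memories) c k Q :
  lockstep 3 m s M c ->
  (forall i : 'I_p, i < m -> regs m i (M i)) ->
  (forall i : 'I_p, i < m -> carried base i (M i)) ->
  (forall i : 'I_p, i < m -> M i 6 = n - base :> nat) ->
  (forall (M' : memories) c', lockstep 5 (minn m (n - base)) s M' c' ->
     (forall i : 'I_p, i < m -> regs m i (M' i)) ->
     (forall i : 'I_p, i < m -> carried base i (M' i)) ->
     (forall i : 'I_p, i < m -> M' i 6 = n - base :> nat) -> wp k Q c') ->
  wp (2 + k) Q c.
Proof.
have w0 := width_gt0.
move=> lock_c Mregs Mcar Mrem wpQ; rewrite -(addnA 1 1).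
apply: (wp_local (code := [:: Arith Lt 7 0 6]) lock_c) => // {lock_c}c lock_c.
apply: wp_step.
  apply: (step_exit lock_c (erefl : onth scan 4 = Some (IfZero 7 47)) _
            (geq_minl m (n - base))) => // i lt_im.
  rewrite -[X in nat_of_ord X]/(eval_arith Lt (M i 0) (M i 6)).
  have [M0 _ _ _] := Mregs i lt_im.
  by rewrite eval_lt // M0 Mrem // geq_min; case: (ltnP i (n - base)); lia.
move=> {lock_c}c lock_c; apply: (wpQ _ _ lock_c).
- exact: Mregs.
- exact: Mcar.
- exact: Mrem.
Qed.

(** The test compares cells 6 and 1, which agree on all running processors, so the branch is
    uniform. *)
Lemma wp_shrink base m s (M : memories) c k Q :
  let m' := minn m (n - base) in
  lockstep 5 m' s M c ->
  (forall i : 'I_p, i < m -> regs m i (M i)) ->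
  (forall i : 'I_p, i < m -> carried base i (M i)) ->
  (forall i : 'I_p, i < m -> M i 6 = n - base :> nat) ->
  (forall (M' : memories) c', lockstep 8 m' s M' c' ->
     (forall i : 'I_p, i < m' -> regs m' i (M' i)) ->
     (forall i : 'I_p, i < m' -> carried base i (M' i)) ->
     (forall i : 'I_p, i < m' -> M' i 6 = n - base :> nat) -> wp k Q c') ->
  wp (3 + k) Q c.
Proof.
have w0 := width_gt0.
move=> m' lock_c Mregs Mcar Mrem wpQ; rewrite -(addnA 1 2) -(addnA 1 1).
apply: (wp_local (code := [:: Arith Lt 7 6 1]) lock_c) => // {lock_c}c lock_c.
have lt_m (i : 'I_p) : i < m' -> i < m by rewrite leq_min => /andP[].
have [legc branch] := step_branch lock_c (erefl : onth scan 6 = Some (IfZero 7 8)).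
right; split=> //; move: (branch (m <= n - base)) => {branch lock_c legc}.
have M7 (i : 'I_p) : i < m' ->
    (exec [:: Arith Lt 7 6 1] (M i) 7 == 0 :> nat) = (m <= n - base).
  move=> /lt_m lt_im; have [_ Mm _ _] := Mregs i lt_im.
  rewrite -[X in nat_of_ord X]/(eval_arith Lt (M i 6) (M i 1)) eval_lt //.
  by rewrite Mrem // Mm; case: ltnP.
move=> /(_ M7) {M7}.
case: leqP => [le_mn|lt_nm] /= lock_c.
  have m'E : m' = m by apply/minn_idPl.
  apply: wp_mono (leq_addl 1 _) _; apply: wpQ lock_c _ _ _.
  - by rewrite m'E; exact: Mregs.
  - by rewrite m'E; exact: Mcar.
  - by rewrite m'E; exact: Mrem.
have m'E : m' = n - base by apply/minn_idPr/ltnW.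
apply: (wp_local (code := [:: Move 1 6]) lock_c) => //.
move=> {lock_c}c lock_c; apply: (wpQ _ _ lock_c) => i /lt_m lt_im.
- by have [M0 _ M3 M5] := Mregs i lt_im; split=> //; rewrite m'E; exact: Mrem.
- exact: Mcar.
- exact: Mrem.
Qed.

(** Induction on a bound [k] for the number of chunks left; the final 2 pays for the test at which
    all processors halt. *)
Lemma wp_chunks k base m s (M : memories) c :
  lockstep 3 m s M c -> 0 < m <= p -> base <= n -> n - base <= k * m ->
  (forall i : 'I_p, i < m -> regs m i (M i)) ->
  (forall i : 'I_p, i < m -> carried base i (M i)) ->
  (forall i : 'I_p, i < m -> M i 6 = n - base :> nat) ->
  scanned base s ->
  wp (chunk_cost * k + 2) final c.
Proof.
have lt_nw := len_fits I; have w0 := width_gt0.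
elim: k base m s M c => [|k IH] base m s M c lock_c m_bnd le_n le_k.
all: move=> Mregs Mcar Mrem s_base.
all: case: (posnP (n - base)) => [rem0|rem_gt0].
all: try by move: le_k; rewrite mul0n; lia.
1, 2: apply: wp_mono (leq_addl _ 2) _; rewrite -(addn0 2).
1, 2: apply: (wp_halt lock_c Mregs Mcar Mrem) => M' c' lock_c' _ _ _.
1, 2: have [_ off_c' sh_c'] := lock_c'.
1, 2: split=> [i|x lt_xn]; first by apply: off_c'; rewrite rem0 minn0.
1, 2: by rewrite sh_c' s_base ifT //; lia.
have -> : chunk_cost * k.+1 + 2 = 2 + (3 + (22 + 17 * (trunc_log 2 n).+1 +
  (chunk_cost * k + 2))) by rewrite mulnS /chunk_cost; lia.
apply: (wp_halt lock_c Mregs Mcar Mrem) => {lock_c Mregs Mcar Mrem}M {}c lock_c.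
move=> Mregs Mcar Mrem; apply: (wp_shrink lock_c Mregs Mcar Mrem).
move=> {lock_c Mregs Mcar Mrem}M {}c lock_c Mregs Mcar Mrem.
apply: (wp_chunk lock_c _ _ Mregs Mcar Mrem s_base); [lia | lia |].
move=> s' {lock_c Mregs Mcar Mrem}M {}c lock_c Mregs Mcar Mrem s'_base.
apply: (IH _ _ _ _ _ lock_c _ _ _ Mregs Mcar Mrem s'_base); [lia | lia |].
(* After a shortened chunk nothing is left; otherwise one multiple of [m] has been removed. *)
by move: le_k; rewrite /minn mulSn; case: ltnP; nia.
Qed.

Definition scan_cost : nat := 3 + (chunk_cost * (n %/ p).+1 + 2).

Lemma wp_scan : wp scan_cost final (init I).
Proof.
have lt_nw := len_fits I; have w0 := width_gt0.
have p_gt0 := nproc_gt0 I; have le_pn := nproc_le I.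
have lock0 : lockstep 0 p (entry : memory w) (@init_priv I) (init I).
  by split=> // i; rewrite leqNgt ltn_ord.
apply: (wp_local (code := [:: Const 5 1; Move 4 3; Move 6 2]) lock0) => //.
move=> c lock_c; apply: (wp_chunks (base := 0) lock_c) => //.
- by rewrite p_gt0 leqnn.
- by rewrite subn0 ltnW // ltn_ceil.
- move=> i lt_ip; split=> //=; rewrite modn_small //; first by lia.
  + by lia.
  + by rewrite -[1]/(2 ^ 0) ltn_exp2l.
- move=> i lt_ip; split; first by rewrite /= modn_small.
  by rewrite /segment big_geq // if_same.
- by move=> i lt_ip; rewrite subn0 /= modn_small.
Qed.

End Scan.

(** * Resources *)

Section Halting.

Variables (P : program) (I : instance).

Local Notation w := (width I).
Local Notation p := (nproc I).

Definition halted (c : config w p) : Prop := forall i, ~~ active P (proc c i).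

Lemma halted_step c : halted c ->
  halted (step P c) /\ shared (step P c) = shared c.
Proof.
move=> off_c; split=> [i|]; first by rewrite /= step_inactive.
by apply: shared_step_id => i a b; rewrite inactive_onth.
Qed.

Lemma halted_iter k c : halted c ->
  halted (iter k (@step P I) c) /\ shared (iter k (@step P I) c) = shared c.
Proof.
move=> off_c; elim: k => // k [off_k sh_k]; rewrite iterS.
by have [off_Sk ->] := halted_step off_k.
Qed.

Lemma halted_run t u : halted (run P I t) -> t <= u ->
  halted (run P I u) /\ shared (run P I u) = shared (run P I t).
Proof. by move=> off_t le_tu; rewrite -(subnK le_tu) /run iterD; exact: halted_iter. Qed.

Lemma halted_legal c : halted c -> legal P c.
Proof.
move=> off_c; have noc i : shared_cells P (proc c i) = [::].
  by rewrite /shared_cells inactive_onth.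
by split=> [i j _|i a]; rewrite !noc.
Qed.

Lemma operations_halted t T (i : 'I_p) :
  halted (run P I t) -> operations P T i <= t.
Proof.
move=> off_t; apply: leq_trans (geq_minr T t).
rewrite /operations; elim: T => [|T IH]; first by rewrite big_ord0.
rewrite big_ord_recr /=; case: (ltnP T t) => [lt_Tt|le_tT].
  by apply: leq_trans (leq_add IH (leq_b1 _)) _; lia.
have [/(_ i)/negPf-> _] := halted_run off_t le_tT.
by rewrite addn0 (leq_trans IH) //; lia.
Qed.

Lemma shared_space_legal T :
  (forall t, legal P (run P I t)) -> shared_space P I T = len I.
Proof.
move=> leg; apply/eqP; rewrite eqn_leq leq_maxl andbT geq_max leqnn /=.
apply/bigmax_leqP => t _; apply/bigmax_leqP => i _.
apply/bigmax_leqP_seq => a a_cell _; exact: (leg t).2 a_cell.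
Qed.

(** A static check: [Fetch] and [Put] are rejected because their address depends on the memory
    contents. *)
Definition accesses_below (b : nat) (ins : instr) : bool :=
  match ins with
  | Const d _ => d < b
  | Move d a | Read d a => (d < b) && (a < b)
  | Arith _ d a1 a2 | Combine d a1 a2 => [&& d < b, a1 < b & a2 < b]
  | Write a1 a2 => (a1 < b) && (a2 < b)
  | IfZero a _ => a < b
  | Goto _ => true
  | Fetch _ _ | Put _ _ => false
  end.

Lemma private_space_le b T (i : 'I_p) :
  4 <= b -> all (accesses_below b) P -> private_space P T i <= b.
Proof.
move=> le4b all_P; rewrite geq_max le4b /=; apply/bigmax_leqP => t _.
apply/bigmax_leqP_seq => a a_cell _; move: a_cell.
have onth_P l ins : onth P l = Some ins -> accesses_below b ins.
  elim: P l all_P => [|ins' P' IH] [|l] //= /andP[ok oks]; last exact: IH.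
  by case=> <-.
rewrite /private_cells; case: onth (@onth_P (pc (proc (run P I t) i))) => //= ins.
move/(_ _ erefl); case: ins => [d ?|d ?|? d ? ?|d ? ?|d ?|? ?|d ?|? ?|?|? ?] //=;
  by rewrite ?inE; lia.
Qed.

End Halting.

(** * Bounds for [scan] and the conclusion *)

Lemma scan_run (I : instance) :
  exists2 t, t <= scan_cost I &
    final (run scan I t) /\ forall u, legal scan (run scan I u).
Proof.
have [t le_t [fin_t leg]] := wp_run (wp_scan I).
exists t => //; split=> // u; case: (ltnP u t) => [/leg //|le_tu].
by apply: halted_legal; have [] := halted_run fin_t.1 le_tu.
Qed.

(** Let [L] be the logarithm, at least 1 here, and [q] the quotient. Then [p * (q + 1) <= 2n] and
    [44 + 17 L <= 61 L] give 122 n L; the other 5 steps cost at most 5 n L. *)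
Lemma scan_cost_le (I : instance) : 1 < len I ->
  nproc I * scan_cost I <= 127 * (len I * trunc_log 2 (len I) ^ 1).
Proof.
move=> n_gt1; have le_pn := nproc_le I.
have log_gt0 : 0 < trunc_log 2 (len I) by rewrite trunc_log_gt0.
have le_q := leq_divM (len I) (nproc I).
rewrite /scan_cost /chunk_cost expn1; move: le_pn log_gt0 le_q.
move: (len I) (nproc I) (len I %/ nproc I) (trunc_log 2 (len I)) => n p q L; nia.
Qed.

Lemma segment_prefix (I : instance) i : i <= len I ->
  segment I 0 i = \big[combine I/unit_word I]_(x <- take i (input I)) x.
Proof.
move=> le_i; rewrite (big_nth (to_word (width I) 0)) size_takel ?size_tuple //.
by rewrite /segment !big_nat; apply: eq_bigr => j /andP[_ lt_ji]; rewrite nth_take.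
Qed.

Theorem corollary15 :
  exists P : program, synchronous_strict_PIP P /\ solves_parallel_prefix P.
Proof.
(* The largest private address named in [scan] is 15, a scratch cell of [select]. *)
have space I T (i : 'I_(nproc I)) : private_space scan T i <= 16.
  exact: private_space_le.
have alloc I T : allocated_shared scan I T = 0.
  rewrite /allocated_shared shared_space_legal ?subnn // => t.
  by have [u _ [_ leg]] := scan_run I.
exists scan; split; first split.
- move=> I; have [t _ [fin_t leg]] := scan_run I.
  split; last by exists t; exact: fin_t.1.
  by move=> u i j; exact: (leg u).1.
- by move=> I T _; exact: alloc.
- by exists 4, 16; split=> // I T _ i; rewrite space leq_maxl.
- exists 127, 1, 2 => I T n_gt1 _; apply: leq_trans (scan_cost_le n_gt1).
  have [t le_t [fin_t _]] := scan_run I; rewrite leq_mul2l; apply/orP; right.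
  apply/bigmax_leqP => i _; apply: leq_trans le_t.
  exact: operations_halted fin_t.1.
- exists 16 => I T p1 _; rewrite /additional_space alloc add0n.
  apply: (@leq_trans (\sum_(i < nproc I) 16)).
    by apply: leq_sum => i _; exact: space.
  by rewrite sum_nat_const card_ord p1.
move=> I T fin_T i lt_i; rewrite -segment_prefix 1?ltnW //.
have [t _ [fin_t _]] := scan_run I; rewrite -fin_t.2 //.
(* Shared memory is frozen from the earlier of the two halting times on. *)
case: (leqP t T) => [/(halted_run fin_t.1)[_ ->] //|/ltnW le_Tt].
by have [_ ->] := halted_run fin_T le_Tt.
Qed.
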